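(* Let $n\ge 1$, let $\Gamma$ be a crystallographic group in $\mathbb{R}^{n+1}$ with lattice $\mathcal{L}$ and point group $\mathbf{J}$, and let $y_0>0$. Then the group $\widetilde{\mathcal{L}}_{y_0}\subset\mathbb{R}^n$ of common periods of all functions in $\Pi_{y_0}(X_\Gamma)$, regarded as a $\mathbb{Z}$-module, has at most $n$ generators (i.e. it can be generated by at most $n$ elements). If either $(0,y_0)\in\mathcal{L}$ or $\sigma\in\mathbf{J}$, then $\widetilde{\mathcal{L}}_{y_0}$ is a lattice in $\mathbb{R}^n$.
   Context: Points of $\mathbb{R}^{n+1}$ are written $(x,y)$ with $x\in\mathbb{R}^n$, $y\in\mathbb{R}$. A lattice in $\mathbb{R}^m$ is the set of all integer combinations of $m$ linearly independent vectors of $\mathbb{R}^m$. The Euclidean group $\mathbf{E}(m)=\mathbb{R}^m\ltimes\mathbf{O}(m)$ consists of pairs $(v,\delta)$, acting by $(v,\delta)\cdot z=v+\delta z$. A crystallographic group $\Gamma\le\mathbf{E}(n+1)$ with lattice $\mathcal{L}$ is a subgroup such that $\mathcal{L}=\{v:(v,\mathrm{Id}_{n+1})\in\Gamma\}$ is a lattice in $\mathbb{R}^{n+1}$; its point group is $\mathbf{J}=\{\delta\in\mathbf{O}(n+1):(v,\delta)\in\Gamma\text{ for some }v\in\mathbb{R}^{n+1}\}$. $\sigma\in\mathbf{O}(n+1)$ is the reflection $\sigma(x,y)=(x,-y)$. $X_\Gamma$ is the vector space of all $C^1$ functions $f:\mathbb{R}^{n+1}\to\mathbb{R}$ that are $\Gamma$-invariant,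 i.e. $f(\gamma^{-1}\cdot(x,y))=f(x,y)$ for all $\gamma\in\Gamma$ and all $(x,y)$. The projection operator is $\Pi_{y_0}(f)(x)=\int_0^{y_0}f(x,y)\,dy$, $x\in\mathbb{R}^n$, and $\Pi_{y_0}(X_\Gamma)=\{\Pi_{y_0}(f):f\in X_\Gamma\}$. The group of common periods is $\widetilde{\mathcal{L}}_{y_0}=\{p\in\mathbb{R}^n: g(x+p)=g(x)\ \forall x\in\mathbb{R}^n,\ \forall g\in\Pi_{y_0}(X_\Gamma)\}$. *)

(* Defs.v *)
From HB Require Import structures.
From mathcomp Require Import all_boot all_order all_algebra.
From mathcomp Require Import all_classical all_reals all_analysis.
Set Implicit Arguments.
Unset Strict Implicit.
Unset Printing Implicit Defensive.
Import Order.TTheory GRing.Theory Num.Theory.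
Import numFieldNormedType.Exports.
Local Open Scope classical_set_scope.
Local Open Scope ring_scope.

(* The point (x, y) of R^(n+1); vectors are columns, so that an orthogonal
   matrix d acts by z |-> d *m z. *)
Definition pt (R : realType) (n : nat) (x : 'cV[R]_n) (y : R) : 'cV[R]_(n + 1) :=
  col_mx x y%:M.

Definition orthogonal_group (R : realType) (m : nat) : set 'M[R]_m :=
  [set d | d^T *m d = 1%:M].

(* Elements of the Euclidean group E(m) are the pairs (v, d) with d orthogonal;
   the multiplication below is the one making [euclid_act] a left action. *)
Definition euclidean_group (R : realType) (m : nat) :
    set ('cV[R]_m * 'M[R]_m) :=
  [set g | orthogonal_group g.2].

Definition euclid_act (R : realType) (m : nat) (g : 'cV[R]_m * 'M[R]_m)
    (z : 'cV[R]_m) : 'cV[R]_m := g.1 + g.2 *m z.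

Definition euclid_one (R : realType) (m : nat) : 'cV[R]_m * 'M[R]_m :=
  (0, 1%:M).

Definition euclid_mul (R : realType) (m : nat) (g h : 'cV[R]_m * 'M[R]_m) :
    'cV[R]_m * 'M[R]_m :=
  (g.1 + g.2 *m h.1, g.2 *m h.2).

Definition euclid_inv (R : realType) (m : nat) (g : 'cV[R]_m * 'M[R]_m) :
    'cV[R]_m * 'M[R]_m :=
  (- (invmx g.2 *m g.1), invmx g.2).

Definition euclid_subgroup (R : realType) (m : nat)
    (G : set ('cV[R]_m * 'M[R]_m)) : Prop :=
  [/\ G `<=` @euclidean_group R m,
      G (euclid_one R m),
      forall g h, G g -> G h -> G (euclid_mul g h) &
      forall g, G g -> G (euclid_inv g)].

Definition is_lattice (R : realType) (m : nat) (L : set 'cV[R]_m) : Prop :=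
  exists b : m.-tuple 'cV[R]_m, free b /\ L = [set v | inIntSpan b v].

Definition generated_by_at_most (V : zmodType) (n : nat) (A : set V) : Prop :=
  exists k : nat, exists s : k.-tuple V,
    (k <= n)%N /\ A = [set v | inIntSpan s v].

Definition translations (R : realType) (m : nat)
    (G : set ('cV[R]_m * 'M[R]_m)) : set 'cV[R]_m :=
  [set v | G (v, 1%:M)].

Definition point_group (R : realType) (m : nat)
    (G : set ('cV[R]_m * 'M[R]_m)) : set 'M[R]_m :=
  [set d | orthogonal_group d /\ exists v, G (v, d)].

Definition crystallographic (R : realType) (m : nat)
    (G : set ('cV[R]_m * 'M[R]_m)) : Prop :=
  euclid_subgroup G /\ is_lattice (translations G).

Definition sigma (R : realType) (n : nat) : 'M[R]_(n + 1) :=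
  block_mx 1%:M 0 0 (- 1%:M).

(* In finite dimension, continuity of z |-> 'd f z amounts to continuity of all
   the directional derivatives. *)
Definition C1 (R : realType) (m : nat) (f : 'cV[R]_m -> R) : Prop :=
  (forall z, differentiable f z) /\
  (forall v : 'cV[R]_m, continuous (fun z => 'D_v f z)).

Definition invariant_C1 (R : realType) (n : nat)
    (G : set ('cV[R]_(n + 1) * 'M[R]_(n + 1))) : set ('cV[R]_(n + 1) -> R) :=
  [set f | C1 f /\
     forall g, G g -> forall x y, f (euclid_act (euclid_inv g) (pt x y)) = f (pt x y)].

Definition projection (R : realType) (n : nat) (y0 : R)
    (f : 'cV[R]_(n + 1) -> R) : 'cV[R]_n -> R :=
  fun x => Rintegral lebesgue_measure `[0, y0] (fun y => f (pt x y)).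

Definition common_periods (R : realType) (n : nat) (y0 : R)
    (G : set ('cV[R]_(n + 1) * 'M[R]_(n + 1))) : set 'cV[R]_n :=
  [set p | forall x g, (projection y0 @` invariant_C1 G) g -> g (x + p) = g x].

Lemma pt_sigma (R : realType) (n : nat) (x : 'cV[R]_n) (y : R) :
  sigma R n *m pt x y = pt x (- y).
Proof.
by rewrite /sigma /pt mul_block_col mul1mx !mul0mx addr0 add0r mulNmx mul1mx
  raddfN.
Qed.

Lemma euclid_actM (R : realType) (m : nat) (g h : 'cV[R]_m * 'M[R]_m) z :
  euclid_act (euclid_mul g h) z = euclid_act g (euclid_act h z).
Proof. by rewrite /euclid_act /euclid_mul /= mulmxDr mulmxA addrA. Qed.

Lemma euclid_mulV (R : realType) (m : nat) (g : 'cV[R]_m * 'M[R]_m) :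
  euclidean_group g -> euclid_mul (euclid_inv g) g = euclid_one R m.
Proof.
move=> /mulmx1_unit [_ u].
by rewrite /euclid_mul /euclid_inv /euclid_one /= mulVmx// addNr.
Qed.

(* Main.v *)
Require Import Defs.
From mathcomp Require Import all_boot all_order all_algebra.
From mathcomp Require Import all_classical all_reals all_analysis.
From mathcomp Require Import ring lra zify.
Import Order.TTheory GRing.Theory Num.Theory.
Import numFieldNormedType.Exports.
Local Open Scope classical_set_scope.
Local Open Scope ring_scope.

(** Let P be the group of common periods and L the translation lattice.

    The heart of the matter is that P is discrete. Choose a nonnegative
    Gamma-invariant C^1 function W whose zero set is exactly the orbit Gamma.0
    of the origin ([orbit_defect]). For every c > 0 the function
    max(0, c - W)^2 lies in X_Gamma, and its projection is positive at x = 0,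
    because W(0, 0) = 0. Let p be a common period and let c be the minimum of
    W on the compact segment {p} x [0, y0]. If c were positive, the projection
    would vanish at p, although a period p gives it the same value at 0 and at
    p. So c = 0: every common period p has a point (p, y) of the orbit above
    it with 0 <= y <= y0 ([common_period_zero]). A bounded part of
    R^n x [0, y0] contains finitely many orbit points, hence P is locally
    finite.

    To build W, write L = B Z^m. The function z |-> sum_i sin^2(pi (B^-1 z)_i)
    is L-periodic, and vanishes exactly on L. The point group J is finite: in
    the basis B its elements are integer matrices, and these are bounded because
    the elements of J are orthogonal. W is the product, over d in J, of that
    function composed with the inverse of an element of Gamma with linear part
    d; multiplying by an element of Gamma permutes the factors.

    A locally finite subgroup of R^n has a linearly independent Z-basis
    ([discrete_subgroup_basis]), which has at most n elements, and exactly n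
    when the subgroup spans R^n. In the two special cases it does: the
    projections to R^n of the vectors of L span R^n ([shadows_span]), and

    - if (0, y0) is in L, every f in X_Gamma is y0-periodic in y, so that the
      integral over [0, y0] is taken over a full period and a translation by
      (a, b) in L acts on the projection as a translation by a
      ([common_period_shadow]);
    - if sigma is in J, then L is sigma-invariant and contains
      (a, b) + (a, -b) = (2a, 0), whose first component is a common period. *)

(** * Locally finite subgroups of R^n *)

Section DiscreteSubgroups.
Context {R : realType} {n : nat}.
Local Notation V := 'cV[R]_n.

Lemma inIntSpan_cons {k} (c : k.-tuple V) x q v :
  inIntSpan c v -> inIntSpan [tuple of x :: c] (x *~ q + v).
Proof.
move=> [a ->]; exists [ffun i => oapp a q (unlift ord0 i)].
rewrite big_ord_recl/= ffunE unlift_none/=; congr (_ + _).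
by apply: eq_bigr => i _; rewrite ffunE liftK.
Qed.

Variable P : set V.
Hypothesis P0 : P 0.
Hypothesis PB : forall x y, P x -> P y -> P (x - y).

Lemma subgroupD x y : P x -> P y -> P (x + y).
Proof. by move=> Px Py; rewrite -(opprK y) -(sub0r y); apply: PB => //; apply: PB. Qed.

Lemma subgroupMz x q : P x -> P (x *~ q).
Proof.
move=> Px; have Pn m : P (x *+ m).
  by elim: m => [//|m IH]; rewrite mulrS; apply: subgroupD.
by case: q => m; rewrite ?NegzE ?mulrNz -?pmulrn // -sub0r; apply: PB.
Qed.

Lemma subgroup_inIntSpan {k} (c : k.-tuple V) v :
  (forall i, P c`_i) -> inIntSpan c v -> P v.
Proof.
move=> Pc [a ->]; elim/big_ind: _ => // [x y|i _]; first exact: subgroupD.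
exact: subgroupMz.
Qed.

(** Rounding the real coordinates down moves any vector of the span into a
    bounded region, by an element of the subgroup. *)
Lemma span_round {k} (c : k.-tuple V) u : u \in <<c>>%VS ->
  exists2 w, inIntSpan c w & `|u - w| <= \sum_(i < k) `|c`_i|.
Proof.
move=> /coord_span uE.
exists (\sum_(i < k) c`_i *~ Num.floor (coord c i u)).
  exists [ffun i => Num.floor (coord c i u)].
  by apply: eq_bigr => i _; rewrite ffunE.
rewrite [X in `|X - _|]uE -sumrB (le_trans (ler_norm_sum _ _ _))//.
apply: ler_sum => i _; rewrite -scaler_int -scalerBl normrZ ler_piMl//.
have /andP[] := floor_itv (coord c i u).
by rewrite intrD => ? ?; rewrite ger0_norm ?subr_ge0// lerBlDl ltW.
Qed.

Lemma finite_min (A : set R) : finite_set A -> A !=set0 ->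
  exists2 m, A m & forall t, A t -> m <= t.
Proof.
move=> /finite_seqP[s ->]; elim: s => [|x s IH]; first by case.
move=> _; case: (pselect ([set` s] !=set0)) => [/IH[m /= ms mle]|s0]; last first.
  exists x => [|t]; first by rewrite /= mem_head.
  by rewrite /= inE => /predU1P[->//|ts]; case: s0; exists t.
have [xm|mx] := leP x m.
  exists x => [|t]; first by rewrite /= mem_head.
  by rewrite /= inE => /predU1P[->//|/mle]; apply: le_trans.
exists m => [|t]; first by rewrite /= inE ms orbT.
by rewrite /= inE => /predU1P[->|/mle//]; apply: ltW.
Qed.

Hypothesis Pfin : forall r : R, finite_set (P `&` [set p | `|p| <= r]).

(** The third clause, that no vector of P in the span of c is missed, is what
    the induction on the size of c has to preserve. *)
Definition adapted {k} (c : k.-tuple V) : Prop :=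
  [/\ free c, forall i, P c`_i &
      forall p, P p -> p \in <<c>>%VS -> inIntSpan c p].

(** Among the vectors of P of the form t b + u with 0 < t <= 1 and u in the
    span of c, choose one whose height t is least; this is possible because
    rounding u leaves finitely many candidates. Any vector of P in the extended
    span is then an integer multiple of the chosen one plus a vector of <<c>>:
    a fractional remainder would give a smaller height. *)
Lemma adapted_extend {k} (c : k.-tuple V) b :
  adapted c -> P b -> b \notin <<c>>%VS -> exists c' : k.+1.-tuple V, adapted c'.
Proof.
move=> [fc Pc ac] Pb bc.
have fbc : free (b :: c) by rewrite free_cons bc.
(* phi reads off the height t of t b + u. *)
pose phi (p : V) := coord [tuple of b :: c] ord0 p.
have phiE t u : u \in <<c>>%VS -> phi (t *: b + u) = t.
  move=> uc; rewrite /phi linearD linearZ/=.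
  rewrite (_ : b = [tuple of b :: c]`_(ord0 : 'I_k.+1))// coord_free// eqxx mulr1.
  rewrite (coord_span uc) linear_sum big1 ?addr0// => i _.
  rewrite linearZ/= (_ : c`_i = [tuple of b :: c]`_(lift ord0 i))//.
  by rewrite coord_free//= mulr0.
pose A := [set t | 0 < t <= 1 /\ exists2 u, u \in <<c>>%VS & P (t *: b + u)].
have Afin : finite_set A.
  have := Pfin (`|b| + \sum_(i < k) `|c`_i|).
  move=> /(finite_image phi); apply: sub_finite_set => t [/andP[t0 t1] [u uc Ptu]].
  have [w wc uw] := span_round c u uc.
  have wP := subgroup_inIntSpan c w Pc wc.
  have ws : w \in <<c>>%VS.
    case: wc => a ->; apply: memv_suml => i _.
    by rewrite -scaler_int memvZ// memv_span// mem_nth// size_tuple.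
  exists (t *: b + (u - w)); last by rewrite phiE// memvB.
  split; first by rewrite addrA; apply: PB.
  rewrite /= (le_trans (ler_normD _ _))// lerD// normrZ ler_piMl//.
  by rewrite gtr0_norm.
have A1 : A 1.
  by split; [rewrite ltr01 lexx|exists 0; rewrite ?mem0v// scale1r addr0].
(* The new basis vector t b + u, of least height. *)
have [t [/andP[t0 t1] [u uc Ptu]] tmin] := finite_min A Afin (ex_intro _ _ A1).
exists [tuple of t *: b + u :: c]; split.
- rewrite free_cons fc andbT; apply: contra bc => tbuc.
  have : t *: b \in <<c>>%VS by rewrite -(addrK u (t *: b)) memvB.
  by move=> /(memvZ t^-1); rewrite scalerA mulVf ?gt_eqF// scale1r.
- by case.
- move=> p Pp; rewrite span_cons => /memv_addP[_ /vlineP[a ->] [w wc pE]].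
  have /andP[q0 q1] := floor_itv a.
  have Ppq : P (p - (t *: b + u) *~ Num.floor a) by apply: PB => //; apply: subgroupMz.
  move: q0 q1 Ppq; set q := Num.floor a => q0 q1 Ppq.
  have pqE : p - (t *: b + u) *~ q = ((a - q%:~R) * t) *: b + ((a - q%:~R) *: u + w).
    by rewrite pE -scaler_int addrAC -scalerBl scalerDr scalerA addrA.
  have ruw : (a - q%:~R) *: u + w \in <<c>>%VS by rewrite memvD// memvZ.
  have r0 : a - q%:~R = 0.
    apply/eqP; move: q0; rewrite -subr_ge0 le_eqVlt eq_sym => /predU1P[->//|r0].
    have r1 : a - q%:~R < 1 by rewrite ltrBlDl -(intrD _ q 1).
    have rt : (a - q%:~R) * t < t by rewrite gtr_pMl.
    suff /tmin : A ((a - q%:~R) * t) by rewrite leNgt rt.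
    split; first by rewrite mulr_gt0//= (le_trans (ltW rt)).
    by exists ((a - q%:~R) *: u + w) => //; rewrite -pqE.
  move: pqE Ppq; rewrite r0 mul0r !scale0r !add0r => pqE.
  rewrite pqE => /ac/(_ wc) /(inIntSpan_cons c (t *: b + u) q).
  by have -> : p = (t *: b + u) *~ q + w by rewrite -pqE addrC subrK.
Qed.

(** Extend the empty family as long as P is not in its span; free families have
    at most n elements, so this stops. *)
Lemma discrete_subgroup_basis :
  exists k, exists c : k.-tuple V, adapted c /\ forall p, P p -> p \in <<c>>%VS.
Proof.
suff step m : forall k (c : k.-tuple V), adapted c -> (n <= k + m)%N ->
    exists k', exists c : k'.-tuple V, adapted c /\ forall p, P p -> p \in <<c>>%VS.
  apply: (step n 0%N [tuple]); last by rewrite add0n.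
  split=> [|i|p _]; rewrite ?nil_free// ?nth_nil//.
  rewrite span_nil memv0 => /eqP ->; exists [ffun=> 0].
  by rewrite big_ord0.
have dimle k (c : k.-tuple V) : free c -> (k <= n)%N.
  move=> fc; rewrite -(size_tuple c) -(eqP fc).
  by rewrite (leq_trans (dimvS (subvf _)))// dimvf/= /dim/= muln1.
elim: m => [|m IH] k c ac nk.
  exists k, c; split=> // p Pp; apply: contrapT => /negP pc.
  have [c' [/dimle]] := adapted_extend c p ac Pp pc.
  by rewrite addn0 in nk; rewrite ltnNge nk.
case: (pselect (forall p, P p -> p \in <<c>>%VS)) => [Pc|]; first by exists k, c.
move=> /existsNP[p /not_implyP[Pp /negP pc]].
have [c' ac'] := adapted_extend c p ac Pp pc.
by apply: IH ac' _; rewrite addSnnS.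
Qed.

End DiscreteSubgroups.

(** * Functions of class C^1 *)

Section C1Calculus.
Context {R : realType} {m : nat}.
Local Notation V := 'cV[R]_m.
Implicit Types f g : V -> R.

(** [C1] is stated through all directional derivatives, so each closure property
    below is a formula for ['D_v] together with the continuity of its terms. *)
Lemma C1_cst (a : R) : C1 (fun _ : V => a).
Proof.
split=> [z|v]; first exact: differentiable_cst.
rewrite (_ : (fun z => 'D_v _ z) = cst (0 : R)); first exact: (@cst_continuous V R).
by apply/funext => z; rewrite derive_cst.
Qed.

Lemma C1_continuous f : C1 f -> continuous f.
Proof. by move=> [df _] z; apply: differentiable_continuous. Qed.

Lemma C1_derivable f z v : C1 f -> derivable f z v.
Proof. by move=> [df _]; apply: diff_derivable. Qed.

Lemma C1D f g : C1 f -> C1 g -> C1 (fun z => f z + g z).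
Proof.
move=> Cf Cg; split=> [z|v].
  by apply: differentiableD; [exact: Cf.1|exact: Cg.1].
rewrite (_ : (fun z => 'D_v _ z) = (fun z => 'D_v f z + 'D_v g z)).
  by move=> z; exact: (@continuousD R R V _ _ z (Cf.2 v z) (Cg.2 v z)).
by apply/funext => z; rewrite deriveD//; exact: C1_derivable.
Qed.

Lemma C1M f g : C1 f -> C1 g -> C1 (fun z => f z * g z).
Proof.
move=> Cf Cg; split=> [z|v].
  by apply: differentiableM; [exact: Cf.1|exact: Cg.1].
rewrite (_ : (fun z => 'D_v _ z) = (fun z => f z * 'D_v g z + g z * 'D_v f z)).
  move=> z; have fz := C1_continuous f Cf z; have gz := C1_continuous g Cg z.
  exact: (@continuousD R R V _ _ z (@continuousM R V _ _ z fz (Cg.2 v z))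
                                   (@continuousM R V _ _ z gz (Cf.2 v z))).
by apply/funext => z; rewrite deriveM//; exact: C1_derivable.
Qed.

Lemma C1_coord i : C1 (fun z : V => z i 0).
Proof.
split=> [z|v]; first exact: differentiable_coord.
rewrite (_ : (fun z => 'D_v _ z) = cst (v i 0 : R)); first exact: (@cst_continuous V R).
apply/funext => z; rewrite /derive; apply: cvg_lim => //.
apply/(@cvg_near_cst _ _ _ _ _).
near=> h => /=.
rewrite !mxE addrK [_ *: _]mulrA mulVf ?mul1r//.
by near: h; exact: nbhs_dnbhs_neq.
Unshelve. all: by end_near. Qed.

Lemma C1_comp (phi : R -> R) f : (forall s, derivable phi s 1) ->
  continuous (derive1 phi) -> C1 f -> C1 (fun z => phi (f z)).
Proof.
move=> dphi cphi Cf; have dp s : differentiable phi s by apply/derivable1_diffP.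
split=> [z|v]; first by apply: differentiable_comp => //; exact: Cf.1.
rewrite (_ : (fun z => 'D_v _ z) = (fun z => 'D_v f z * derive1 phi (f z))).
  move=> z; apply: (@continuousM R V _ _ z (Cf.2 v z)).
  exact: (continuous_comp (C1_continuous f Cf z) (cphi (f z))).
apply/funext => z; rewrite deriveE; last by apply: differentiable_comp => //; exact: Cf.1.
rewrite diff_comp//=; last exact: Cf.1.
by rewrite diff1E// -deriveE//; exact: Cf.1.
Qed.

Lemma C1_sum I (s : seq I) (F : I -> V -> R) :
  (forall i, C1 (F i)) -> C1 (fun z => \sum_(i <- s) F i z).
Proof.
move=> CF; elim: s => [|i s IH].
  by rewrite (_ : (fun z => _) = fun=> 0); [exact: C1_cst|apply/funext => z; rewrite big_nil].
rewrite (_ : (fun z => _) = fun z => F i z + \sum_(j <- s) F j z); first exact: C1D.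
by apply/funext => z; rewrite big_cons.
Qed.

Lemma C1_prod I (s : seq I) (F : I -> V -> R) :
  (forall i, C1 (F i)) -> C1 (fun z => \prod_(i <- s) F i z).
Proof.
move=> CF; elim: s => [|i s IH].
  by rewrite (_ : (fun z => _) = fun=> 1); [exact: C1_cst|apply/funext => z; rewrite big_nil].
rewrite (_ : (fun z => _) = fun z => F i z * \prod_(j <- s) F j z); first exact: C1M.
by apply/funext => z; rewrite big_cons.
Qed.

Lemma C1_mulmx_coord {p} (A : 'M[R]_(p, m)) i : C1 (fun z : V => (A *m z) i 0).
Proof.
rewrite (_ : (fun z => _) = fun z : V => \sum_(j <- index_enum 'I_m) A i j * z j 0).
  by apply: C1_sum => j; apply: C1M; [exact: C1_cst|exact: C1_coord].
by apply/funext => z; rewrite mxE.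
Qed.

End C1Calculus.

Section Profiles.
Context {R : realType}.

(** Squaring the truncation makes it C^1 in s; it vanishes exactly for
    s >= c. *)
Definition bump (c s : R) : R := Num.max 0 (c - s) ^+ 2.

Lemma is_derive_quadratic_error (f : R -> R) (s d : R) :
  (forall h, `|f (s + h) - f s - h * d| <= h ^+ 2) -> is_derive s 1 f d.
Proof.
move=> fsh.
have fd : (fun h => h^-1 *: ((f \o shift s) (h *: (1 : R)) - f s)) @ 0^' --> d.
  apply/cvgrPdist_le => e e0; near=> h.
  have h0 : h != 0 by near: h; exact: nbhs_dnbhs_neq.
  have he : `|h| <= e by near: h; apply: dnbhs0_le.
  have -> : d - h^-1 *: ((f \o shift s) (h *: (1 : R)) - f s) =
            - (h^-1 * (f (s + h) - f s - h * d)).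
    by rewrite /= /shift/= !/GRing.scale/= mulr1 addrC [h + s]addrC; field.
  rewrite normrN normrM (le_trans _ he)// normfV ler_pdivrMl ?normr_gt0//.
  by rewrite -expr2 real_normK ?num_real// fsh.
by apply: DeriveDef; [apply: cvgP fd|apply: cvg_lim fd].
Unshelve. all: by end_near. Qed.

(** A quadratic bound on the error of the linear approximation treats the
    corner s = c together with the smooth parts. *)
Lemma is_derive_bump (c s : R) :
  is_derive s 1 (bump c) (- (Num.max 0 (c - s) *+ 2)).
Proof.
apply: is_derive_quadratic_error => h; rewrite /bump.
by case: (leP 0 (c - (s + h))) => ?; case: (leP 0 (c - s)) => ?;
  rewrite ler_norml; apply/andP; split; nra.
Qed.

Lemma derivable_bump c s : derivable (bump c) s 1.
Proof. by case: (is_derive_bump c s). Qed.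

Lemma continuous_bump' c : continuous (derive1 (bump c)).
Proof.
rewrite (_ : derive1 (bump c) = fun s => - (Num.max 0 (c - s) *+ 2)); last first.
  by apply/funext => s; rewrite derive1E; case: (is_derive_bump c s).
move=> s.
have c0 : {for s, continuous (fun _ : R => 0 : R^o)} by exact: cvg_cst.
have cs : {for s, continuous (fun x : R => c - x : R^o)}.
  by apply: cvgB; [exact: cvg_cst|exact: cvg_id].
by apply: cvgN; apply: cvgMn; exact: (continuous_max c0 cs).
Qed.

(** A smooth function of period 1 that vanishes exactly at the integers. *)
Definition sin2pi (t : R) : R := sin (pi * t) ^+ 2.

Lemma derivable_sin2pi t : derivable sin2pi t 1.
Proof. exact: ex_derive. Qed.

Lemma continuous_sin2pi' : continuous (derive1 sin2pi).
Proof.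
rewrite (_ : derive1 sin2pi = fun t => (sin (pi * t) * cos (pi * t) * pi) *+ 2); last first.
  apply/funext => s; rewrite derive1E /sin2pi derive_val.
  by rewrite /GRing.scale/= mulr1 mulrA mulr2n.
move=> t; apply: differentiable_continuous; apply/derivable1_diffP.
exact: ex_derive.
Qed.

Lemma sin2pi_ge0 t : 0 <= sin2pi t.
Proof. exact: sqr_ge0. Qed.

Lemma sin2piDn t (n : nat) : sin2pi (t + n%:R) = sin2pi t.
Proof.
elim: n => [|n IH]; first by rewrite addr0.
by rewrite -natr1 addrA /sin2pi mulrDr mulr1 sinDpi sqrrN -/(sin2pi (t + n%:R)) IH.
Qed.

Lemma sin2piDz t (k : int) : sin2pi (t + k%:~R) = sin2pi t.
Proof.
case: k => k; first exact: sin2piDn.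
by rewrite NegzE intrN -[LHS](sin2piDn _ k.+1) addrNK.
Qed.

Lemma sin2pi_eq0 t : sin2pi t = 0 -> t \is a Num.int.
Proof.
rewrite -(sin2piDz _ (- Num.floor t)) => /eqP; rewrite sqrf_eq0 => /eqP st.
have /andP[q0 q1] := floor_itv t.
have r1 : t - (Num.floor t)%:~R < 1 by rewrite ltrBlDl -(intrD _ _ 1).
move: st; rewrite intrN; move: q0 r1; rewrite -subr_ge0.
rewrite le_eqVlt => /predU1P[/esym/eqP|r0 r1 s0].
  by rewrite subr_eq0 => /eqP tE _ _; apply/intrP; exists (Num.floor t).
suff : 0 < sin (pi * (t - (Num.floor t)%:~R)) by rewrite s0 ltxx.
by apply: sin_gt0_pi; rewrite mulr_gt0 ?pi_gt0//= gtr_pMr// pi_gt0.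
Qed.

End Profiles.

(** * Integrals of continuous functions *)

Section Integrals.
Context {R : realType}.
Local Notation mu := (@lebesgue_measure R).
Implicit Types h : R -> R.

Lemma continuous_integrable_itv h a b : continuous h ->
  mu.-integrable `[a, b] (EFin \o h).
Proof.
move=> ch; apply: continuous_compact_integrable; first exact: segment_compact.
exact: continuous_subspaceT.
Qed.

Lemma Rintegral_itv_cat h a b c : a <= b -> b <= c -> continuous h ->
  Rintegral mu `[a, c] h = Rintegral mu `[a, b] h + Rintegral mu `[b, c] h.
Proof.
move=> ab bc ch; rewrite -(@Rintegral_itv_obnd_cbnd _ b (BRight c)); last first.
  apply: integrableS (continuous_integrable_itv h b c ch) => //.
  exact: subset_itv_oc_cc.
rewrite -(@Rintegral_itvB _ h (BLeft a) (BRight c) b) ?bnd_simp//.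
  by rewrite addrC subrK.
exact: continuous_integrable_itv.
Qed.

Lemma Rintegral_gt0 h a b : a < b -> continuous h -> (forall y, 0 <= h y) ->
  0 < h a -> 0 < Rintegral mu `[a, b] h.
Proof.
move=> ab ch h0 ha.
have /cvgrPdist_le /(_ (h a / 2)) := ch a.
rewrite divr_gt0// => /(_ isT) /nbhs_ballP[e /= e0 eP].
pose c := Num.min b (a + e / 2).
have ac : a < c by rewrite lt_min ab ltrDl divr_gt0.
have cb : c <= b by rewrite ge_min lexx.
rewrite (Rintegral_itv_cat h a c b)// ?ltW// ltr_pwDl ?Rintegral_ge0//.
have := @le_Rintegral _ _ _ mu `[a, c]%classic (cst (h a / 2)) h.
rewrite Rintegral_cst//= lebesgue_measure_itv/= lte_fin ac -EFinD/=.
move=> le_int; apply: lt_le_trans (le_int _ _ _ _) => //.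
- by rewrite mulr_gt0 ?divr_gt0// subr_gt0.
- by apply: continuous_integrable_itv => y; exact: cvg_cst.
- exact: continuous_integrable_itv.
move=> y; rewrite /= in_itv/= => /andP[ay yc].
have /eP : ball a e y.
  rewrite /ball/= distrC ger0_norm ?subr_ge0// ltrBlDl.
  move: yc; rewrite le_min => /andP[_ yc]; apply: le_lt_trans yc _.
  by rewrite ltrD2l ltr_pdivrMr// ltr_pMr// ltr1n.
by rewrite ler_norml => /andP[_]; lra.
Qed.

Lemma Rintegral_shift h a b s : a <= b -> continuous h ->
  Rintegral mu `[a, b] (fun y => h (y + s)) = Rintegral mu `[a + s, b + s] h.
Proof.
move=> ab ch; rewrite /Rintegral; congr fine.
pose F (y : R) := y + s.
have F' : derive1 F = cst 1.
  by apply/funext => y; rewrite derive1E derive_val addr0.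
rewrite -/(F a) -/(F b) (integration_by_substitution_increasing (F := F))//.
- by apply: eq_integral => y _; rewrite F' /= mulr1.
- by move=> x y _ _ xy; rewrite ltrD2r.
- by rewrite F' => y _; exact: cvg_cst.
- by rewrite F'; apply/cvg_ex; exists 1; exact: cvg_cst.
- by rewrite F'; apply/cvg_ex; exists 1; exact: cvg_cst.
- by split=> [y _||]; [exact: ex_derive| |]; [apply: cvg_at_right_filter|apply: cvg_at_left_filter];
    (apply: cvgD; [exact: cvg_id|exact: cvg_cst]).
- by apply: continuous_subspaceT.
Qed.

(** Only the residue r of s modulo T matters, and for 0 <= r < T the piece of
    [r, T + r] beyond T is the translate of [0, r]. *)
Lemma Rintegral_periodic h T s : 0 < T -> continuous h -> periodic h T ->
  Rintegral mu `[0, T] (fun y => h (y + s)) = Rintegral mu `[0, T] h.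
Proof.
move=> T0 ch hT; have hTz y (q : int) : h (y + q%:~R * T) = h y.
  rewrite mulrzl; case: q => q; first by rewrite (periodicn hT q y).
  by rewrite NegzE mulrNz -pmulrn -[LHS](periodicn hT q.+1) addrNK.
have /andP[q0 q1] := floor_itv (s / T); set q := Num.floor _ in q0 q1.
have [r0 rT] : 0 <= s - q%:~R * T /\ s - q%:~R * T < T.
  rewrite subr_ge0 -ler_pdivlMr// ltrBlDr.
  have -> : T + q%:~R * T = (q + 1)%:~R * T by rewrite intrD mulrDl mul1r addrC.
  by rewrite -ltr_pdivrMr.
have -> : (fun y => h (y + s)) = (fun y => h (y + (s - q%:~R * T))).
  by apply/funext => y; rewrite -(hTz (y + (s - q%:~R * T)) q) addrA subrK.
move: r0 rT; set r := s - _ => r0 rT.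
rewrite Rintegral_shift ?ltW// add0r.
rewrite (Rintegral_itv_cat h r T (T + r) (ltW rT)) ?lerDl//.
have -> : Rintegral mu `[T, T + r] h = Rintegral mu `[0, r] h.
  rewrite -[X in `[X, _]](add0r T) (addrC T) -Rintegral_shift//.
  by congr Rintegral; apply/funext => y; exact: hT.
by rewrite addrC -Rintegral_itv_cat// ltW.
Qed.

End Integrals.

(** * Integer and orthogonal matrices, lattices *)

Section Matrices.
Context {R : realType}.

(** Both the finiteness of the point group and that of the bounded part of an
    orbit are instances of this. *)
Lemma finite_int_matrices p q (C : R) :
  finite_set [set A : 'M[R]_(p, q) |
    forall i j, A i j \is a Num.int /\ `|A i j| <= C].
Proof.
pose N := (Num.truncn C).+1.
have CN : C < N%:R by exact: truncnS_gt.
(* Entries in [-N, N] are shifted by N to be indexed by 'I_(N + N).+1. *)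
pose f (M : 'M['I_(N + N).+1]_(p, q)) : 'M[R]_(p, q) :=
  \matrix_(i, j) ((M i j)%:R - N%:R).
apply: (@sub_finite_set _ _ (f @` setT)); last first.
  by apply: finite_image; exact: finite_finset.
move=> A AP; exists (\matrix_(i, j) inord (absz (Num.floor (A i j) + N%:Z)%R)) => //.
apply/matrixP => i j; rewrite !mxE.
have [/intrP[k ->] kC] := AP i j; rewrite intrKfloor.
have kN : `|k| < N%:Z by rewrite -(ltr_int R) intr_norm (le_lt_trans kC).
have kN0 : 0 <= k + N%:Z by move: kN; rewrite ltr_norml => /andP[]; lia.
rewrite inordK; last first.
  by rewrite ltnS -lez_nat gez0_abs//; move: kN; rewrite ltr_norml => /andP[]; lia.
by rewrite natr_absz ger0_norm// intrD addrK.
Qed.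

Lemma mulmx_entry_le p q s (A : 'M[R]_(p, q)) (B : 'M[R]_(q, s)) a b :
  (forall i j, `|A i j| <= a) -> (forall i j, `|B i j| <= b) ->
  forall i j, `|(A *m B) i j| <= q%:R * (a * b).
Proof.
move=> Aa Bb i j; rewrite mxE (le_trans (ler_norm_sum _ _ _))//.
have -> : q%:R * (a * b) = \sum_(k < q) a * b.
  by rewrite sumr_const card_ord mulr_natl.
by apply: ler_sum => k _; rewrite normrM ler_pM.
Qed.

Lemma entry_le_bound p q (A : 'M[R]_(p, q)) :
  exists a, forall i j, `|A i j| <= a.
Proof.
exists (\sum_i \sum_j `|A i j|) => i j.
rewrite (bigD1 i)//= (bigD1 j)//= -addrA lerDl addr_ge0// sumr_ge0// => k _.
exact: sumr_ge0.
Qed.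

Lemma orthogonal_entry_le1 m (d : 'M[R]_m) : orthogonal_group d ->
  forall i j, `|d i j| <= 1.
Proof.
move=> /matrixP dd i j; have := dd j j; rewrite !mxE eqxx (bigD1 i)//= !mxE.
move=> dd1; rewrite -(@ler_pXn2r _ 2)// ?nnegrE// expr1n real_normK ?num_real//.
move: dd1; rewrite -expr2 => dd1; rewrite -[leRHS]/(1%:R) -dd1 lerDl sumr_ge0// => k _.
by rewrite mxE -expr2 sqr_ge0.
Qed.

Lemma orthogonal_unit m (d : 'M[R]_m) : orthogonal_group d -> d \in unitmx.
Proof. by move=> /mulmx1_unit[]. Qed.

(** For invertible B, the integer combinations of the columns of B, described
    by coordinates so that membership is a condition on real numbers. *)
Definition column_lattice {m} (B : 'M[R]_m) : set 'cV[R]_m :=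
  [set z | forall i, (invmx B *m z) i 0 \is a Num.int].

Lemma lattice_matrix m (L : set 'cV[R]_m) : is_lattice L ->
  exists2 B : 'M[R]_m, B \in unitmx &
    L = column_lattice B.
Proof.
move=> [b [fb ->]]; pose B : 'M[R]_m := \matrix_(i, j) b`_j i 0.
have BE (a : 'cV_m) : B *m a = \sum_j a j 0 *: b`_j.
  apply/colP => i; rewrite mxE summxE; apply: eq_bigr => j _.
  by rewrite !mxE mulrC.
have uB : B \in unitmx.
  rewrite -unitmx_tr unitmxE unitfE; apply/negP => /det0P[v v0 vB].
  case/eqP: v0; apply/rowP => j; rewrite mxE.
  move/freeP: (fb) => /(_ (fun j => v 0 j)); apply.
  rewrite -[RHS](trmx0 R 1 m) -vB trmx_mul trmxK BE.
  by apply: eq_bigr => i _; rewrite mxE.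
exists B => //; apply/seteqP; split => z /=.
  move=> [a ->] i; have -> : \sum_(i < m) b`_i *~ a i = B *m \col_j (a j)%:~R.
    by rewrite BE; apply: eq_bigr => j _; rewrite mxE scaler_int.
  by rewrite mulKmx// mxE intr_int.
move=> zint; exists [ffun i => Num.floor ((invmx B *m z) i 0)].
rewrite -[LHS](mulKVmx uB) BE; apply: eq_bigr => i _.
by rewrite ffunE -scaler_int floorK.
Qed.

End Matrices.

(** * The coordinates (x, y) *)

Section Points.
Context {R : realType} {n : nat}.

Lemma pt_eq (z : 'cV[R]_(n + 1)) : z = pt (usubmx z) (dsubmx z 0 0).
Proof. by rewrite /pt -mx11_scalar vsubmxK. Qed.

Lemma ptD (x x' : 'cV[R]_n) y y' : pt x y + pt x' y' = pt (x + x') (y + y').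
Proof. by rewrite /pt add_col_mx -raddfD. Qed.

Lemma pt_affine (x : 'cV[R]_n) y : pt x y = pt x 0 + y *: pt 0 1.
Proof.
by rewrite /pt scale_col_mx scaler0 scale_scalar_mx mulr1 add_col_mx addr0
  -raddfD/= add0r.
Qed.

Lemma pt_continuous (x : 'cV[R]_n) : continuous (pt x).
Proof.
rewrite (_ : pt x = fun y => pt x 0 + y *: pt 0 1); last first.
  by apply/funext => y; exact: pt_affine.
move=> y; apply: cvgD; first exact: cvg_cst.
exact: scalel_continuous.
Qed.

Lemma continuous_pt (f : 'cV[R]_(n + 1) -> R) x : continuous f ->
  continuous (fun y => f (pt x y)).
Proof.
move=> cf y; exact: (continuous_comp (pt_continuous x y) (cf (pt x y))).
Qed.

End Points.

(** * An invariant function vanishing exactly on the orbit of the origin *)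

Section Crystallographic.
Context {R : realType} {m : nat}.
Variable G : set ('cV[R]_m * 'M[R]_m).
Hypothesis hG : euclid_subgroup G.
Local Notation L := (translations G).

Lemma linear_part_orthogonal g : G g -> orthogonal_group g.2.
Proof. by case: hG => + _ _ _; exact. Qed.

Lemma euclid_inv_act (g : 'cV[R]_m * 'M[R]_m) z :
  euclid_act (euclid_inv g) z = invmx g.2 *m (z - g.1).
Proof. by rewrite /euclid_act/= mulmxBr addrC. Qed.

Lemma same_linear_part u v d : G (u, d) -> G (v, d) -> L (u - v).
Proof.
case: hG => _ _ GM GV Gu Gv; have := GM _ _ Gu (GV _ Gv).
have /orthogonal_unit ud := linear_part_orthogonal (u, d) Gu.
by rewrite /euclid_mul/= mulmxN mulKVmx// mulmxV.
Qed.

Lemma point_group_inv d : point_group G d -> point_group G (invmx d).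
Proof.
case: hG => GO _ _ GV [_ [v Gv]]; have Gi := GV _ Gv.
by split; [exact: (GO _ Gi)|exists (- (invmx d *m v))].
Qed.

Lemma point_group_mul d e :
  point_group G d -> point_group G e -> point_group G (d *m e).
Proof.
case: hG => GO _ GM _ [_ [v Gv]] [_ [w Gw]]; have Gvw := GM _ _ Gv Gw.
by split; [exact: (GO _ Gvw)|exists (v + d *m w)].
Qed.

(** Conjugating a translation by l with (v, d) gives the translation by d l. *)
Lemma point_group_lattice d l : point_group G d -> L l -> L (d *m l).
Proof.
case: hG => GO _ GM _ [od [v Gv]] Ll; have := GM _ _ Gv Ll.
rewrite /euclid_mul/= mulmx1 => Gvl.
by rewrite -(addKr v (d *m l)) addrC; exact: same_linear_part Gvl Gv.
Qed.

Lemma translations0 : L 0.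
Proof. by case: hG. Qed.

Lemma translationsB l l' : L l -> L l' -> L (l - l').
Proof. exact: same_linear_part. Qed.

Lemma translationsD l l' : L l -> L l' -> L (l + l').
Proof.
move=> Ll Ll'; rewrite -(opprK l') -(sub0r l'); apply: translationsB => //.
by apply: translationsB => //; exact: translations0.
Qed.

Variable B : 'M[R]_m.
Hypothesis uB : B \in unitmx.
Hypothesis LE : L = column_lattice B.

Lemma lattice_col j : L (col j B).
Proof.
by rewrite LE => i; rewrite colE mulmxA mulVmx// mul1mx mxE natr_int.
Qed.

(** In the basis B an element d of the point group becomes K = B^-1 d B, an
    integer matrix since d preserves L, whose entries are bounded since those
    of d are at most 1 in absolute value. *)
Lemma finite_point_group : finite_set (point_group G).
Proof.
have [a aB] := entry_le_bound _ _ (invmx B); have [b bB] := entry_le_bound _ _ B.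
have := finite_int_matrices m m (m%:R * (a * (m%:R * (1 * b)))).
move=> /(finite_image (fun K => B *m K *m invmx B)); apply: sub_finite_set.
move=> d Jd; exists (invmx B *m (d *m B)); last first.
  by rewrite mulKVmx// mulmxK.
move=> i j; split; last first.
  apply: mulmx_entry_le => //; apply: mulmx_entry_le => //.
  exact: orthogonal_entry_le1 Jd.1.
have := point_group_lattice d _ Jd (lattice_col j).
rewrite LE => /(_ i); congr (_ \is a _).
by rewrite colE !mulmxA -colE mxE.
Qed.

(** A C^1 substitute for the distance to L: L-periodic, zero exactly on L. *)
Definition lattice_defect (z : 'cV[R]_m) : R :=
  \sum_i sin2pi ((invmx B *m z) i 0).

Lemma lattice_defect_ge0 z : 0 <= lattice_defect z.
Proof. by apply: sumr_ge0 => i _; exact: sin2pi_ge0. Qed.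

Lemma lattice_defectD z l : L l -> lattice_defect (z + l) = lattice_defect z.
Proof.
rewrite LE => Ll; apply: eq_bigr => i _; rewrite mulmxDr mxE.
by case/intrP: (Ll i) => k ->; rewrite sin2piDz.
Qed.

Lemma lattice_defect_eq0 z : lattice_defect z = 0 -> L z.
Proof.
move=> /eqP; rewrite psumr_eq0; last by move=> i _; exact: sin2pi_ge0.
move=> /allP z0; rewrite LE => i; apply: sin2pi_eq0.
by apply/eqP; exact: (z0 i (mem_index_enum i)).
Qed.

Lemma lattice_defect0 : lattice_defect 0 = 0.
Proof.
by rewrite /lattice_defect big1// => i _; rewrite mulmx0 mxE /sin2pi mulr0 sin0 expr0n.
Qed.

(** Picks one representative of each coset of L in G. *)
Definition shift_of (d : 'M[R]_m) : 'cV[R]_m := xget 0 [set v | G (v, d)].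

Lemma shift_ofP d : point_group G d -> G (shift_of d, d).
Proof. by move=> [_ [v Gv]]; exact: (@xgetI _ 0 [set v | G (v, d)] v). Qed.

Variable s : seq 'M[R]_m.
Hypothesis us : uniq s.
Hypothesis sE : point_group G = [set` s].

(** Vanishes exactly on the translate shift_of d + d L, the part of the orbit of 0 that
    comes from the elements of G with linear part d. *)
Definition coset_defect (d : 'M[R]_m) (z : 'cV[R]_m) : R :=
  lattice_defect (invmx d *m (z - shift_of d)).

Definition orbit_defect (z : 'cV[R]_m) : R := \prod_(d <- s) coset_defect d z.

Lemma orbit_defect_ge0 z : 0 <= orbit_defect z.
Proof. by apply: prodr_ge0 => d _; exact: lattice_defect_ge0. Qed.

Lemma C1_orbit_defect : C1 orbit_defect.
Proof.
apply: C1_prod => d; apply: C1_sum => i.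
pose A := invmx B *m invmx d.
rewrite (_ : (fun z => _) = fun z : 'cV[R]_m =>
    sin2pi ((A *m z) i 0 + - (A *m shift_of d) i 0)); last first.
  by apply/funext => z; rewrite mulmxA mulmxBr !mxE.
apply: C1_comp; first exact: derivable_sin2pi.
  exact: continuous_sin2pi'.
by apply: C1D; [exact: C1_mulmx_coord|exact: C1_cst].
Qed.

(** Two elements of G with the same linear part differ by a translation in L, so
    the choice made by [shift_of] is immaterial. *)
Lemma coset_defectE u d z : G (u, d) ->
  coset_defect d z = lattice_defect (invmx d *m (z - u)).
Proof.
move=> Gu; have Jd : point_group G d by split; [exact: (linear_part_orthogonal _ Gu)|exists u].
have Ll := same_linear_part _ _ _ Gu (shift_ofP _ Jd).
rewrite -(lattice_defectD _ _ (point_group_lattice _ _ (point_group_inv _ Jd) Ll)).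
by congr lattice_defect; rewrite -mulmxDr subrKA.
Qed.

(** Composing with the inverse of g = (v, d) turns the factor of e into the
    factor of d e, so it permutes the factors. *)
Lemma orbit_defect_invariant g z : G g ->
  orbit_defect (euclid_act (euclid_inv g) z) = orbit_defect z.
Proof.
case: g => v d Gg; have od := linear_part_orthogonal _ Gg.
have Jd : point_group G d by split=> //; exists v.
have ud := orthogonal_unit _ _ od.
have sP e : (e \in s) <-> point_group G e by rewrite sE.
have ps : perm_eq [seq d *m e | e <- s] s.
  apply: uniq_perm => //.
    by rewrite map_inj_uniq//; exact: (can_inj (mulKmx ud)).
  move=> e; apply/mapP/idP => [[f /sP Jf ->]|/sP Je].
    by apply/sP; exact: point_group_mul.
  exists (invmx d *m e); last by rewrite mulKVmx.
  by apply/sP; apply: point_group_mul => //; exact: point_group_inv.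
rewrite /orbit_defect -[RHS](perm_big _ ps)/= big_map; apply: eq_big_seq => e /sP Je.
have Ge := shift_ofP _ Je; case: hG => _ _ GM _; have Gde := GM _ _ Gg Ge.
rewrite (coset_defectE _ _ _ Gde) /coset_defect euclid_inv_act/=.
have ue := orthogonal_unit _ _ Je.1.
have -> : invmx (d *m e) = invmx e *m invmx d.
  have ude : d *m e \in unitmx by rewrite unitmx_mul ud.
  apply: (can_inj (mulKmx ude)).
  by rewrite mulmxV// mulmxA mulmxK// mulmxV.
by rewrite -mulmxA opprD addrA [in RHS]mulmxBr mulKmx.
Qed.

Lemma orbit_defect0 : orbit_defect 0 = 0.
Proof.
have J1 : point_group G 1%:M.
  by split; [rewrite /orthogonal_group/= trmx1 mulmx1|exists 0; exact: translations0].
have s1 : 1%:M \in s by have := J1; rewrite sE.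
apply/eqP; rewrite prodf_seq_eq0; apply/hasP; exists 1%:M => //=.
by rewrite (coset_defectE 0 1%:M 0 translations0) subr0 mulmx0 lattice_defect0.
Qed.

(** The zeros are the vectors shift_of d + d B k with k integer; there are
    finitely many d, and a bound on such a vector bounds k. *)
Lemma finite_orbit_bounded (r : R) :
  finite_set [set z | orbit_defect z = 0 /\ forall i, `|z i 0| <= r].
Proof.
apply: (@sub_finite_set _ _ (\bigcup_(d in [set` s])
   ((fun k => shift_of d + d *m (B *m k)) @`
     [set k : 'cV[R]_m | (forall i j, k i j \is a Num.int) /\
       forall i, `|(d *m (B *m k) + shift_of d) i 0| <= r]))).
  move=> z [/eqP + zr]; rewrite prodf_seq_eq0 => /hasP[d ds /eqP dz].
  have Jd : point_group G d by rewrite sE.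
  have ud := orthogonal_unit _ _ Jd.1.
  have zE : z = shift_of d + d *m (B *m (invmx B *m (invmx d *m (z - shift_of d)))).
    by rewrite !mulKVmx// addrC subrK.
  exists d => //; exists (invmx B *m (invmx d *m (z - shift_of d))) => //.
  split=> [i j|i]; last by rewrite addrC -zE.
  by rewrite ord1; have := lattice_defect_eq0 _ dz; rewrite LE; exact.
apply: bigcup_finite; first exact: finite_seq.
move=> d ds; apply: finite_image.
have Jd : point_group G d by rewrite sE.
have ud := orthogonal_unit _ _ Jd.1.
have [a aB] := entry_le_bound _ _ (invmx B *m invmx d).
have [b bB] := entry_le_bound _ _ (shift_of d).
have := finite_int_matrices m 1 (m%:R * (a * (r + b))); apply: sub_finite_set.
move=> k [kint kr] i j; split; first exact: kint.
have -> : k = (invmx B *m invmx d) *m ((d *m (B *m k) + shift_of d) - shift_of d).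
  by rewrite addrK -mulmxA !mulKmx.
apply: mulmx_entry_le => // i' j'; rewrite ord1.
move: (d *m (B *m k) + _) (kr) => z zr.
by rewrite !mxE (le_trans (ler_normB _ _))// lerD.
Qed.

End Crystallographic.

(** * Common periods *)

Section CommonPeriods.
Context {R : realType} {n : nat}.
Variable G : set ('cV[R]_(n + 1) * 'M[R]_(n + 1)).
Hypothesis hG : crystallographic G.
Variable y0 : R.
Hypothesis hy0 : 0 < y0.
Local Notation L := (translations G).
Local Notation P := (common_periods y0 G).

Let hsub : euclid_subgroup G := hG.1.

Lemma common_periods0 : P 0.
Proof. by move=> x g _; rewrite addr0. Qed.

Lemma common_periodsB p q : P p -> P q -> P (p - q).
Proof.
move=> Pp Pq x g Xg; rewrite addrA addrAC (Pp _ _ Xg).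
by rewrite -[LHS](Pq _ _ Xg) subrK.
Qed.

Lemma invariant_C1_periodic f z l : invariant_C1 G f -> L l -> f (z + l) = f z.
Proof.
move=> [_ fG] Ll; have := fG (l, 1%:M) Ll (usubmx (z + l)) (dsubmx (z + l) 0 0).
by rewrite -pt_eq euclid_inv_act/= invmx1 mul1mx addrK.
Qed.

Lemma common_period_horizontal p : L (pt p 0) -> P p.
Proof.
move=> Lp x _ [f Xf <-]; apply: eq_Rintegral => y _.
by rewrite -[RHS](invariant_C1_periodic f _ _ Xf Lp) ptD addr0.
Qed.

(** Here f is y0-periodic in y, so shifting y by the last coordinate of l does
    not change the integral over [0, y0]. *)
Lemma common_period_shadow l : L (pt 0 y0) -> L l -> P (usubmx l).
Proof.
move=> L0 Ll x _ [f Xf <-]; have cf := C1_continuous f Xf.1.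
have ch := continuous_pt f x cf.
have hT : periodic (fun y => f (pt x y)) y0.
  by move=> y; rewrite -[RHS](invariant_C1_periodic f _ _ Xf L0) ptD addr0.
rewrite /projection -(Rintegral_periodic _ y0 (- dsubmx l 0 0) hy0 ch hT).
apply: eq_Rintegral => y _.
rewrite -[RHS](invariant_C1_periodic f _ _ Xf Ll) [X in _ = f (_ + X)](pt_eq l) ptD.
by rewrite subrK.
Qed.

(** Otherwise W >= c > 0 on the segment {p} x [0, y0], and the projection of the
    invariant function max(0, c - W)^2 vanishes at p; but it is positive at 0,
    since W vanishes at the origin. *)
Lemma common_period_zero (W : 'cV[R]_(n + 1) -> R) p :
  C1 W -> (forall z, 0 <= W z) -> W 0 = 0 ->
  (forall g z, G g -> W (euclid_act (euclid_inv g) z) = W z) ->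
  P p -> exists2 y, 0 <= y <= y0 & W (pt p y) = 0.
Proof.
move=> C1W W_ge0 W0 WG Pp.
have cWp := continuous_subspaceT (continuous_pt W p (C1_continuous W C1W)).
have [y yin ymin] := EVT_min (ltW hy0) (cWp _).
exists y; first by move: yin; rewrite in_itv.
apply/eqP; rewrite eq_le W_ge0 andbT leNgt; apply/negP => Wy.
set c := W (pt p y) in Wy ymin.
have C1f : C1 (fun z => bump c (W z)).
  by apply: C1_comp => //; [exact: derivable_bump|exact: continuous_bump'].
have Xf : invariant_C1 G (fun z => bump c (W z)) by split=> // g Gg x z; rewrite WG.
have := Pp 0 _ (ex_intro2 _ _ _ Xf erefl); rewrite add0r /projection.
rewrite (@eq_Rintegral _ _ _ _ _ (cst 0)); last first.
  move=> z; rewrite inE => /ymin Wz.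
  by rewrite /bump max_l ?expr0n// subr_le0.
rewrite Rintegral_cst// mul0r => /esym f0.
suff : 0 < Rintegral lebesgue_measure `[0, y0] (fun z => bump c (W (pt 0 z))).
  by rewrite f0 ltxx.
apply: (Rintegral_gt0 _ _ _ hy0) => [|z|].
- exact: continuous_pt (C1_continuous _ C1f).
- exact: sqr_ge0.
- by rewrite /pt raddf0 col_mx0 W0 /bump subr0 exprn_gt0// lt_max Wy orbT.
Qed.

Lemma finite_common_periods r : finite_set (P `&` [set p | `|p| <= r]).
Proof.
have [B uB LE] := lattice_matrix _ _ hG.2.
have /finite_seqP[s0 s0E] := finite_point_group G hsub B uB LE.
pose s := undup s0.
have sE : point_group G = [set` s].
  by rewrite s0E; apply/seteqP; split => d /=; rewrite mem_undup.
have := finite_orbit_bounded G B uB LE s sE (Num.max r y0).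
move=> /(finite_image usubmx); apply: sub_finite_set => p [Pp /= pr].
have [y /andP[y0' yy0] Wy] := common_period_zero (orbit_defect G B s) p
  (C1_orbit_defect G B s) (orbit_defect_ge0 G B s) (orbit_defect0 G hsub B LE s sE)
  (orbit_defect_invariant G hsub B LE s (undup_uniq _) sE) Pp.
exists (pt p y); last exact: col_mxKu.
split=> // i; case: (split_ordP i) => j ->.
  rewrite /pt col_mxEu le_max; apply/orP; left; apply: le_trans pr.
  rewrite [`|p|]mx_normrE.
  exact: (le_bigmax _ (fun ij : 'I_n * 'I_1 => `|p ij.1 ij.2|) (j, 0)).
by rewrite /pt col_mxEd !ord1 mxE eqxx mulr1n le_max ger0_norm// yy0 orbT.
Qed.

(** L spans R^(n+1) and the projection to R^n is onto. *)
Lemma shadows_span (U : {vspace 'cV[R]_n}) :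
  (forall l, L l -> usubmx l \in U) -> U = fullv.
Proof.
move=> LU; apply/eqP; rewrite eqEsubv subvf/=; apply/subvP => x _.
have [B uB LE] := lattice_matrix _ _ hG.2.
rewrite -(col_mxKu x (0 : 'cV_1)) -[col_mx _ _](mulKVmx uB).
move: (invmx B *m _) => k; have -> : B *m k = \sum_j k j 0 *: col j B.
  apply/colP => i; rewrite mxE summxE; apply: eq_bigr => j _.
  by rewrite !mxE mulrC.
rewrite linear_sum; apply: memv_suml => j _; rewrite linearZ memvZ//.
exact: LU (lattice_col G B uB LE j).
Qed.

End CommonPeriods.

Theorem theorem5p1 (R : realType) (n : nat) (hn : (1 <= n)%N)
    (G : set ('cV[R]_(n + 1) * 'M[R]_(n + 1))) (hG : crystallographic G)
    (y0 : R) (hy0 : 0 < y0) :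
  generated_by_at_most n (common_periods y0 G) /\
  (translations G (pt 0 y0) \/ point_group G (sigma R n) ->
   is_lattice (common_periods y0 G)).
Proof.
have P0 := common_periods0 G y0; have PB := common_periodsB G y0.
have [k [c [[fc Pc ac] Pspan]]] :=
  discrete_subgroup_basis _ P0 PB (finite_common_periods G hG y0 hy0).
have PE : common_periods y0 G = [set v | inIntSpan c v].
  apply/seteqP; split => p; first by move=> Pp; exact: ac (Pspan _ Pp).
  exact: subgroup_inIntSpan.
have kn : (k <= n)%N.
  rewrite -(size_tuple c) -(eqP fc) (leq_trans (dimvS (subvf _)))//.
  by rewrite dimvf/= /dim/= muln1.
split; first by exists k, c.
move=> hyp; suff full : <<c>>%VS = fullv.
  have kE : k = n.
    by rewrite -(size_tuple c) -(eqP fc) full dimvf/= /dim/= muln1.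
  by clear -fc PE kE; move: c fc PE; rewrite kE => c fc PE; exists c.
apply: (shadows_span G hG) => l Ll; case: hyp => [L0|Js].
  exact/Pspan/common_period_shadow.
(* With l = (a, b), the lattice contains l + sigma l = (2a, 0). *)
have Ps := point_group_lattice _ hG.1 _ _ Js Ll.
suff /Pspan : common_periods y0 G (usubmx l + usubmx l).
  by rewrite -mulr2n -scaler_nat => /(memvZ 2^-1); rewrite scalerA mulVf// scale1r.
apply: common_period_horizontal => //.
have := translationsD _ hG.1 _ _ Ll Ps.
by rewrite [X in X + _](pt_eq l) [X in _ *m X](pt_eq l) pt_sigma ptD subrr.
Qed.
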